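(* Let $G$ be an abelian group of order $n$, suppose that the field $k$ contains a primitive $n^{th}$ root of unity, let $H = k[G]$, and let $B$ be a left $H$-module algebra which is a power of $k$. Let $\mathcal{F}$ be an orthogonal basis of idempotents for $B$. Then: (a) $g\cdot\mathcal{F} = \mathcal{F}$ for all $g \in G$. (b) $B \# H$ is a semisimple algebra. Specifically, let $t$ be the number of $G$-orbits of $\mathcal{F}$ and $n_1, \ldots, n_t$ be their respective lengths. Then $n_\ell$ divides $|G|$ for all $1 \leq \ell \leq t$ and $$B \# H \simeq \bigoplus_{\ell = 1}^t \left(\frac{|G|}{n_\ell}\right)\cdot\mathrm{M}_{n_\ell}(k)$$ as $k$-algebras.
   Context: A power of $k$ is a $k$-algebra $k \times \cdots \times k$ with $m \geq 1$ factors. An orthogonal basis of idempotents for $B$ is a linear basis $\mathcal{F}$ of $B$ such that $1 = \sum_{f \in \mathcal{F}} f$ and $ff' = \delta_{f,f'}f$ for all $f, f' \in \mathcal{F}$. A left $H$-module algebra is an algebra $B$ with a left $H$-module structure such that $h\cdot 1 = \epsilon(h)1$ and $h\cdot(bb') = (h_{(1)}\cdot b)(h_{(2)}\cdot b')$. The smash product $B \# H$ is the algebra on $B \otimes H$ with $(b \# h)(b' \# h') = b(h_{(1)}\cdot b') \# h_{(2)}h'$ and identity $1 \# 1$. $G$ acts on $\mathcal{F}$ via the $H$-module action. $m\cdot V$ is the direct sum (product of algebras) of $m$ copies of $V$; $\mathrm{M}_r(k)$ is the algebra of $r \times r$ matrices over $k$. *)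

(* Defs.v *)
From HB Require Import structures.
From mathcomp Require Import all_boot all_order all_algebra all_fingroup.
From mathcomp Require Import all_field finmap.

Set Implicit Arguments.
Unset Strict Implicit.
Unset Printing Implicit Defensive.

Import GRing.Theory.
Local Open Scope ring_scope.

Section GroupAlgebra.
Variables (k : fieldType) (gT : finGroupType).

Definition grp_alg : Type := {ffun gT -> k^o}.

HB.instance Definition _ := Choice.copy grp_alg {ffun gT -> k^o}.
HB.instance Definition _ := GRing.Zmodule.copy grp_alg {ffun gT -> k^o}.
HB.instance Definition _ := GRing.Lmodule.copy grp_alg {ffun gT -> k^o}.

Definition gelt (g : gT) : grp_alg := [ffun x => (x == g)%:R].

Definition gmul (u v : grp_alg) : grp_alg :=
  [ffun x => \sum_g u g * v (g^-1 * x)%g].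

Fact gmulA : associative gmul.
Proof.
move=> u v w; apply/ffunP => z; rewrite !ffunE.
under [RHS]eq_bigr do rewrite ffunE mulr_suml.
rewrite [RHS]exchange_big; apply: eq_bigr => x _ /=.
rewrite ffunE mulr_sumr [RHS](reindex_inj (mulgI x)); apply: eq_bigr => y _.
by rewrite mulrA mulKg invMg mulgA.
Qed.

Fact gmul1 : left_id (gelt 1%g) gmul.
Proof.
move=> u; apply/ffunP => z; rewrite ffunE (bigD1 1%g) //= big1 => [|x nx].
  by rewrite ffunE eqxx invg1 mul1g mul1r addr0.
by rewrite ffunE (negPf nx) mul0r.
Qed.

Fact gmulr1 : right_id (gelt 1%g) gmul.
Proof.
move=> u; apply/ffunP => z; rewrite ffunE (bigD1 z) //= big1 => [|x nx].
  by rewrite ffunE mulVg eqxx mulr1 addr0.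
by rewrite ffunE -eq_mulVg1 (negPf nx) mulr0.
Qed.

Fact gmulDl : left_distributive gmul +%R.
Proof.
move=> u v w; apply/ffunP => z; rewrite !ffunE -big_split.
by apply: eq_bigr => x _ /=; rewrite ffunE mulrDl.
Qed.

Fact gmulDr : right_distributive gmul +%R.
Proof.
move=> u v w; apply/ffunP => z; rewrite !ffunE -big_split.
by apply: eq_bigr => x _ /=; rewrite ffunE mulrDr.
Qed.

Fact gelt1_neq0 : gelt 1%g != 0.
Proof.
by apply/eqP => /ffunP /(_ 1%g) /eqP; rewrite !ffunE eqxx oner_eq0.
Qed.

HB.instance Definition _ := GRing.Zmodule_isNzRing.Build grp_alg
  gmulA gmul1 gmulr1 gmulDl gmulDr gelt1_neq0.

Fact gscaleAl (a : k) (u v : grp_alg) : a *: (u * v) = (a *: u) * v.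
Proof.
apply/ffunP => z; rewrite !ffunE scaler_sumr.
by apply: eq_bigr => x _; rewrite ffunE scalerAl.
Qed.

HB.instance Definition _ := GRing.Lmodule_isLalgebra.Build k grp_alg gscaleAl.

Fact gscaleAr (a : k) (u v : grp_alg) : a *: (u * v) = u * (a *: v).
Proof.
apply/ffunP => z; rewrite !ffunE scaler_sumr.
by apply: eq_bigr => x _; rewrite ffunE scalerAr.
Qed.

HB.instance Definition _ := GRing.Lalgebra_isAlgebra.Build k grp_alg gscaleAr.

Lemma gelt_mul (g h : gT) : gelt g * gelt h = gelt (g * h)%g.
Proof.
apply/ffunP => z; rewrite ffunE (bigD1 g) //= big1 => [|x nx].
  by rewrite !ffunE eqxx mul1r addr0 -(inj_eq (mulgI g)) mulKVg.
by rewrite ffunE (negPf nx) mul0r.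
Qed.

Lemma grp_alg_sum (h : grp_alg) : h = \sum_g h g *: gelt g.
Proof.
apply/ffunP => z; rewrite sum_ffunE (bigD1 z) //= big1 => [|x nx].
  by rewrite !ffunE eqxx addr0 [_ *: _]mulr1.
by rewrite !ffunE eq_sym (negPf nx) scaler0.
Qed.

(* The linear extension of g |-> 1. *)
Definition counit (h : grp_alg) : k := \sum_g h g.

End GroupAlgebra.

Arguments gelt k {gT} g.

Section Coalgebra.
Variables (k : fieldType) (gT : finGroupType).
Local Notation H := (grp_alg k gT).

(* H (x) H is realized as the group algebra of G x G, with gelt g (x) gelt h
   corresponding to gelt (g, h). *)
Definition comul (h : H) : grp_alg k (gT * gT)%type :=
  \sum_g h g *: gelt k (g, g).

(* sweedler h F is the sum written F h_(1) h_(2) in Sweedler notation: the image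
   of comul h under the linear map H (x) H -> V induced by the bilinear map F. *)
Definition sweedler (V : lmodType k) (h : H) (F : H -> H -> V) : V :=
  \sum_p comul h p *: F (gelt k p.1) (gelt k p.2).

Lemma sweedlerE (V : lmodType k) (h : H) (F : H -> H -> V) :
  sweedler h F = \sum_g h g *: F (gelt k g) (gelt k g).
Proof.
rewrite /sweedler /comul.
under eq_bigr do rewrite sum_ffunE scaler_suml.
rewrite exchange_big; apply: eq_bigr => g _ /=.
rewrite (bigD1 (g, g)) //= big1 => [|p np].
  by rewrite !ffunE eqxx addr0 [_ *: 1]mulr1.
by rewrite !ffunE (negPf np) scaler0 scale0r.
Qed.

Lemma sweedler_gelt (V : lmodType k) (g : gT) (F : H -> H -> V) :
  sweedler (gelt k g) F = F (gelt k g) (gelt k g).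
Proof.
rewrite sweedlerE (bigD1 g) //= big1 => [|x nx].
  by rewrite ffunE eqxx scale1r addr0.
by rewrite ffunE (negPf nx) scale0r.
Qed.

Lemma counit_gelt (g : gT) : counit (gelt k g) = 1.
Proof.
rewrite /counit (bigD1 g) //= big1 => [|x nx]; last by rewrite ffunE (negPf nx).
by rewrite ffunE eqxx addr0.
Qed.

End Coalgebra.

Section ModuleAlgebra.
Variables (k : fieldType) (gT : finGroupType) (B : algType k).
Local Notation H := (grp_alg k gT).

Record module_alg := ModuleAlg {
  hact :> H -> B -> B;
  hact_linearl : forall b, linear (hact^~ b);
  hact_linearr : forall h, linear (hact h);
  hact1 : forall b, hact 1 b = b;
  hactM : forall h h' b, hact (h * h') b = hact h (hact h' b);
  hact_unit : forall h, hact h 1 = counit h *: 1;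
  hact_mul : forall h b b',
    hact h (b * b') = sweedler h (fun h1 h2 => hact h1 b * hact h2 b')
}.

End ModuleAlgebra.

Arguments module_alg {k} gT B.

Section Smash.
Variables (k : fieldType) (gT : finGroupType) (B : algType k).
Variable M : module_alg gT B.
Local Notation H := (grp_alg k gT).

(* B (x) H is realized as functions u : G -> B, u standing for the sum over g of
   u g (x) gelt g. *)
Definition smash (_ : module_alg gT B) : Type := {ffun gT -> B}.

HB.instance Definition _ := Choice.copy (smash M) {ffun gT -> B}.
HB.instance Definition _ := GRing.Zmodule.copy (smash M) {ffun gT -> B}.
HB.instance Definition _ := GRing.Lmodule.copy (smash M) {ffun gT -> B}.

Definition sten (b : B) (h : H) : smash M := [ffun g => h g *: b].

(* The bilinear extension of
   (b # gelt g) (b' # h') = b (g_(1) . b') # g_(2) h';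
   sten_mul gives the formula for all simple tensors. *)
Definition smul (u v : smash M) : smash M :=
  \sum_g \sum_g' sweedler (gelt k g)
    (fun h1 h2 => sten (u g * M h1 (v g')) (h2 * gelt k g')).

Lemma smulE (u v : smash M) x :
  smul u v x = \sum_g u g * M (gelt k g) (v (g^-1 * x)%g).
Proof.
rewrite /smul sum_ffunE; apply: eq_bigr => g _.
rewrite sum_ffunE (bigD1 (g^-1 * x)%g) //= big1 => [|y ny].
  by rewrite sweedler_gelt gelt_mul !ffunE mulKVg eqxx scale1r addr0.
rewrite sweedler_gelt gelt_mul !ffunE.
by rewrite -(inj_eq (mulgI g^-1%g)) mulKg eq_sym (negPf ny) scale0r.
Qed.

Let act0 h : M h 0 = 0.
Proof.
by have := hact_linearr M h (-1) 0 0; rewrite !scaleN1r oppr0 addr0 addNr.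
Qed.
Let actD h b c : M h (b + c) = M h b + M h c.
Proof. by have := hact_linearr M h 1 b c; rewrite !scale1r. Qed.
Let actZ h a b : M h (a *: b) = a *: M h b.
Proof. by have := hact_linearr M h a b 0; rewrite act0 !addr0. Qed.
Let act_sum h (I : finType) (F : I -> B) : M h (\sum_i F i) = \sum_i M h (F i).
Proof. exact: (big_morph _ (actD h) (act0 h)). Qed.
Let act_gM g b c : M (gelt k g) (b * c) = M (gelt k g) b * M (gelt k g) c.
Proof. by rewrite hact_mul sweedler_gelt. Qed.

Fact smulA : associative smul.
Proof.
move=> u v w; apply/ffunP => z; rewrite !smulE.
under [RHS]eq_bigr do rewrite smulE mulr_suml.
rewrite [RHS]exchange_big; apply: eq_bigr => x _ /=.
rewrite smulE act_sum mulr_sumr [RHS](reindex_inj (mulgI x)).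
apply: eq_bigr => y _.
by rewrite act_gM mulrA mulKg invMg mulgA -gelt_mul hactM.
Qed.

Fact smul1 : left_id (sten 1 1) smul.
Proof.
move=> u; apply/ffunP => z; rewrite smulE (bigD1 1%g) //= big1 => [|x nx].
  by rewrite !ffunE eqxx scale1r mul1r invg1 mul1g hact1 addr0.
by rewrite !ffunE (negPf nx) scale0r mul0r.
Qed.

Fact smulr1 : right_id (sten 1 1) smul.
Proof.
move=> u; apply/ffunP => z; rewrite smulE (bigD1 z) //= big1 => [|x nx].
  by rewrite !ffunE mulVg eqxx scale1r hact_unit counit_gelt scale1r mulr1 addr0.
by rewrite !ffunE -eq_mulVg1 (negPf nx) scale0r act0 mulr0.
Qed.

Fact smulDl : left_distributive smul +%R.
Proof.
move=> u v w; apply/ffunP => z; rewrite [RHS]ffunE !smulE -big_split.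
by apply: eq_bigr => x _ /=; rewrite ffunE mulrDl.
Qed.

Fact smulDr : right_distributive smul +%R.
Proof.
move=> u v w; apply/ffunP => z; rewrite [RHS]ffunE !smulE -big_split.
by apply: eq_bigr => x _ /=; rewrite ffunE actD mulrDr.
Qed.

Fact sten1_neq0 : sten 1 1 != 0.
Proof.
apply/eqP => /ffunP /(_ 1%g) /eqP.
by rewrite !ffunE eqxx scale1r oner_eq0.
Qed.

HB.instance Definition _ := GRing.Zmodule_isNzRing.Build (smash M)
  smulA smul1 smulr1 smulDl smulDr sten1_neq0.

Fact sscaleAl (a : k) (u v : smash M) : a *: (u * v) = (a *: u) * v.
Proof.
apply/ffunP => z; rewrite [LHS]ffunE !smulE scaler_sumr.
by apply: eq_bigr => x _; rewrite ffunE scalerAl.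
Qed.

HB.instance Definition _ := GRing.Lmodule_isLalgebra.Build k (smash M) sscaleAl.

Fact sscaleAr (a : k) (u v : smash M) : a *: (u * v) = u * (a *: v).
Proof.
apply/ffunP => z; rewrite [LHS]ffunE !smulE scaler_sumr.
by apply: eq_bigr => x _; rewrite ffunE actZ scalerAr.
Qed.

HB.instance Definition _ := GRing.Lalgebra_isAlgebra.Build k (smash M) sscaleAr.

Lemma sten_mul (b b' : B) (h h' : H) :
  sten b h * sten b' h' =
  sweedler h (fun h1 h2 => sten (b * M h1 b') (h2 * h')).
Proof.
apply/ffunP => x; rewrite smulE sweedlerE sum_ffunE; apply: eq_bigr => g _.
rewrite !ffunE actZ (bigD1 g) //= big1 => [|y ny]; last first.
  by rewrite ffunE (negPf ny) mul0r.
by rewrite ffunE eqxx mul1r addr0 -scalerAr -scalerAl !scalerA mulrC.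
Qed.

Lemma sten_sum (u : smash M) : u = \sum_g sten (u g) (gelt k g).
Proof.
apply/ffunP => x; rewrite sum_ffunE (bigD1 x) //= big1 => [|y ny].
  by rewrite !ffunE eqxx scale1r addr0.
by rewrite !ffunE eq_sym (negPf ny) scale0r.
Qed.

End Smash.

Section Semisimple.
Variable A : pzRingType.

Definition left_ideal (I : A -> Prop) : Prop :=
  [/\ I 0, forall x y, I x -> I y -> I (x + y) & forall a x, I x -> I (a * x)].

Definition minimal_left_ideal (I : A -> Prop) : Prop :=
  [/\ left_ideal I, exists2 x, I x & x != 0 &
      forall J : A -> Prop, left_ideal J -> (forall x, J x -> I x) ->
        (exists2 x, J x & x != 0) -> forall x, I x -> J x].

(* The regular left module is a (finite) direct sum of simple modules. *)
Definition semisimple_alg : Prop :=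
  exists (r : nat) (L : 'I_r -> A -> Prop),
    (forall i, minimal_left_ideal (L i)) /\
    (forall a : A, exists! u : {ffun 'I_r -> A},
       (forall i, L i (u i)) /\ a = \sum_i u i).

End Semisimple.

Section DependentProduct.
Variable I : finType.

Definition prodalg (R : I -> Type) : Type := {dffun forall i, R i}.

Section Zmod.
Variable V : I -> zmodType.
Local Notation T := (prodalg V).
HB.instance Definition _ := Choice.copy T {dffun forall i, V i}.

Definition prodalg0 : T := [ffun i => 0].
Definition prodalg_opp (f : T) : T := [ffun i => - f i].
Definition prodalg_add (f g : T) : T := [ffun i => f i + g i].

Fact prodalg_addA : associative prodalg_add.
Proof. by move=> f g h; apply/ffunP => i; rewrite !ffunE addrA. Qed.
Fact prodalg_addC : commutative prodalg_add.
Proof. by move=> f g; apply/ffunP => i; rewrite !ffunE addrC. Qed.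
Fact prodalg_add0 : left_id prodalg0 prodalg_add.
Proof. by move=> f; apply/ffunP => i; rewrite !ffunE add0r. Qed.
Fact prodalg_addN : left_inverse prodalg0 prodalg_opp prodalg_add.
Proof. by move=> f; apply/ffunP => i; rewrite !ffunE addNr. Qed.

HB.instance Definition _ := GRing.isZmodule.Build T
  prodalg_addA prodalg_addC prodalg_add0 prodalg_addN.
End Zmod.

Section PzRing.
Variable R : I -> pzRingType.
Local Notation T := (prodalg R).

Definition prodalg1 : T := [ffun i => 1].
Definition prodalg_mul (f g : T) : T := [ffun i => f i * g i].

Fact prodalg_mulA : associative prodalg_mul.
Proof. by move=> f g h; apply/ffunP => i; rewrite !ffunE mulrA. Qed.
Fact prodalg_mul1 : left_id prodalg1 prodalg_mul.
Proof. by move=> f; apply/ffunP => i; rewrite !ffunE mul1r. Qed.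
Fact prodalg_mulr1 : right_id prodalg1 prodalg_mul.
Proof. by move=> f; apply/ffunP => i; rewrite !ffunE mulr1. Qed.
Fact prodalg_mulDl : left_distributive prodalg_mul +%R.
Proof. by move=> f g h; apply/ffunP => i; rewrite !ffunE mulrDl. Qed.
Fact prodalg_mulDr : right_distributive prodalg_mul +%R.
Proof. by move=> f g h; apply/ffunP => i; rewrite !ffunE mulrDr. Qed.

HB.instance Definition _ := GRing.Zmodule_isPzRing.Build T
  prodalg_mulA prodalg_mul1 prodalg_mulr1 prodalg_mulDl prodalg_mulDr.
End PzRing.

Section Lmod.
Variables (k : pzRingType) (V : I -> lmodType k).
Local Notation T := (prodalg V).

Definition prodalg_scale (a : k) (f : T) : T := [ffun i => a *: f i].

Fact prodalg_scaleA a b f :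
  prodalg_scale a (prodalg_scale b f) = prodalg_scale (a * b) f.
Proof. by apply/ffunP => i; rewrite !ffunE scalerA. Qed.
Fact prodalg_scale1 : left_id 1 prodalg_scale.
Proof. by move=> f; apply/ffunP => i; rewrite !ffunE scale1r. Qed.
Fact prodalg_scaleDr : right_distributive prodalg_scale +%R.
Proof. by move=> a f g; apply/ffunP => i; rewrite !ffunE scalerDr. Qed.
Fact prodalg_scaleDl f : {morph prodalg_scale^~ f : a b / a + b}.
Proof. by move=> a b; apply/ffunP => i; rewrite !ffunE scalerDl. Qed.

HB.instance Definition _ := GRing.Zmodule_isLmodule.Build k T
  prodalg_scaleA prodalg_scale1 prodalg_scaleDr prodalg_scaleDl.
End Lmod.

End DependentProduct.

Definition power_of_field (k : fieldType) (B : algType k) : Prop :=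
  exists2 m : nat, (0 < m)%N &
    exists phi : {lrmorphism B -> {ffun 'I_m -> k^o}}, bijective phi.

Definition orth_idem_basis (k : fieldType) (B : falgType k) (F : {fset B}) :
  Prop :=
  [/\ basis_of {:B} F,
      1 = \sum_(f <- F) f
    & {in F &, forall f f', f * f' = (f == f')%:R *: f}].

Section Orbits.
Variables (k : fieldType) (gT : finGroupType) (B : algType k).
Variable M : module_alg gT B.

Definition orbit_of (f : B) : {fset B} := [fset M (gelt k g) f | g in gT]%fset.

Definition orbits (F : {fset B}) : {fset {fset B}} :=
  [fset orbit_of f | f in F]%fset.

End Orbits.

(* Main.v *)
Require Import Defs.
From HB Require Import structures.
From mathcomp Require Import all_boot all_order all_algebra all_fingroup.
From mathcomp Require Import all_solvable all_field finmap.

Set Implicit Arguments.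
Unset Strict Implicit.
Unset Printing Implicit Defensive.

Import GRing.Theory.
Local Open Scope ring_scope.

(** Since F is a basis of orthogonal idempotents summing to 1, B is the algebra
    of k-valued functions on F: every b acts on the line spanned by f in F by a
    scalar [eval_at f b], and b is the sum of the [eval_at f b *: f].  The
    elements of F are the only idempotents whose ideal is a line, and G acts by
    algebra automorphisms, so G permutes F ([act_basis]).

    Let O be an orbit of length r, and S the stabiliser of one of its points.
    As G is abelian, S is the stabiliser of every point of O, and it has order
    |G| / r.  A linear character chi of G makes the functions on O into a
    module over B # G, in which b acts by multiplication and g by chi g times
    the permutation of O.  In the basis of points this is a morphism [block]
    from B # G to the r by r matrices, whose (a, b) entry at u is the sum, over
    the elements g that carry b to a, of chi g times the value of u g at a.
    These g form a coset of S, so that the entry is, up to the scalar chi g for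
    one such g, a Fourier coefficient on S of the function u.  Therefore |G| / r
    characters of G whose restrictions to S exhaust the characters of S
    determine u by Fourier inversion ([block_inversion]), and conversely the
    matrices can be prescribed freely ([block_unblock]).  All the blocks, over
    all the orbits, give the isomorphism [smash_iso].

    The required characters come from the regular representation: its matrices
    commute, and each is diagonalizable because k has a primitive root of unity
    of order |G|; in a common eigenbasis the eigenvalues are |G| characters with
    an invertible table ([character_table_unit]).  The |S| columns of this table
    indexed by S have full rank, so |S| of its rows are still independent on S
    ([exists_separating_characters]).

    Semisimplicity is then read off the isomorphism: the diagonal matrix units
    are orthogonal idempotents with sum 1, and each generates a minimal left
    ideal ([semisimple_of_idempotents]). *)

(** * Linear characters of an abelian group *)

Section Characters.
Variables (k : fieldType) (gT : finGroupType).

Definition lin_char (c : gT -> k) : Prop :=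
  c 1%g = 1 /\ {morph c : g h / (g * h)%g >-> g * h}.

Lemma lin_char_neq0 c g : lin_char c -> c g != 0.
Proof.
case=> c1 cM; apply/eqP => c0.
by move/eqP: c1; rewrite -(mulgV g) cM c0 mul0r eq_sym oner_eq0.
Qed.

(* The enumeration [e] of the group has the index type 'I_N.+1, for which square
   matrices form a nontrivial ring, as minimal polynomials require. *)
Section CharacterTable.
Variables (N : nat) (e : 'I_N.+1 -> gT) (e' : gT -> 'I_N.+1).
Hypotheses (eK : cancel e e') (e'K : cancel e' e).

(** With row vectors read as functions v on the group, [v *m regular_mx g] is
    the translate x |-> v (x * g), so that common eigenvectors are multiples of
    characters. *)
Definition regular_mx (g : gT) : 'M[k]_N.+1 :=
  \matrix_(i, j) (e i == e j * g)%g%:R.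

Lemma regular_mxM g h : regular_mx g *m regular_mx h = regular_mx (h * g)%g.
Proof.
apply/matrixP => i l; rewrite !mxE (bigD1 (e' (e l * h)%g)) //= big1 => [|j nj].
  by rewrite !mxE e'K eqxx mulr1 addr0 mulgA.
rewrite !mxE; case: (e j =P (e l * h)%g) => [ej|_]; last by rewrite mulr0.
by rewrite -ej eK eqxx in nj.
Qed.

Lemma regular_mx1 : regular_mx 1%g = 1%:M.
Proof.
by apply/matrixP => i j; rewrite !mxE mulg1 (inj_eq (can_inj eK)).
Qed.

Lemma regular_mxX g m : regular_mx g ^+ m = regular_mx (g ^+ m)%g.
Proof.
elim: m => [|m IH]; first by rewrite expg0 regular_mx1.
by rewrite exprS IH -[_ * _]/(_ *m _) regular_mxM expgSr.
Qed.

(** The minimal polynomial of [regular_mx g] divides 'X^N.+1 - 1, which has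
    simple roots, the powers of z. *)
Lemma regular_mx_diagonalizable (z : k) g :
  N.+1.-primitive_root z -> diagonalizable (regular_mx g).
Proof.
move=> zP; apply/diagonalizableP.
exists [seq z ^+ i | i <- index_iota 0 N.+1].
  rewrite map_inj_in_uniq ?iota_uniq // => i j.
  rewrite !mem_index_iota => iN jN /eqP.
  by rewrite (eq_prim_root_expr zP) !modn_small // => /eqP.
rewrite big_map (factor_Xn_sub_1 zP); apply: mxminpoly_min.
rewrite rmorphB /= rmorphXn /= horner_mx_X rmorph1 regular_mxX.
have oG : #|[set: gT]| = N.+1.
  by rewrite cardsT -(bij_eq_card (Bijective eK e'K)) card_ord.
have -> : (g ^+ N.+1 = 1)%g by rewrite -oG expg_cardG ?inE.
by rewrite regular_mx1 subrr.
Qed.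

(** A common eigenvector v with eigenvalues c satisfies v g = c g * v 1, so it
    is the character c up to the nonzero scalar v 1: an eigenbasis is a diagonal
    matrix times the character table. *)
Lemma character_table_unit (z : k) :
    abelian [set: gT] -> N.+1.-primitive_root z ->
  exists X : 'I_N.+1 -> gT -> k,
    (forall i, lin_char (X i)) /\ (\matrix_(i, j) X i (e j)) \in unitmx.
Proof.
move=> abG zP.
have [P Pu /allP Pdiag] : codiagonalizable [seq regular_mx g | g <- enum gT].
  apply/codiagonalizableP; split=> [_ _ /mapP[g _ ->] /mapP[h _ ->]|].
    rewrite /comm_mx !regular_mxM; congr regular_mx.
    by apply: (centsP abG); rewrite inE.
  by move=> _ /mapP[g _ ->]; apply: regular_mx_diagonalizable zP.
pose X i g := conjmx P (regular_mx g) i i.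
have PX i j g : P i (e' (e j * g)%g) = X i g * P i j.
  have /similar_diagPex[D gD] : similar_diag P (regular_mx g).
    by apply: Pdiag; rewrite map_f ?mem_enum.
  have /matrixP/(_ i j) := similarP Pu gD.
  rewrite mul_diag_mx /X (eqP gD) !mxE eqxx mulr1n => <-.
  rewrite (bigD1 (e' (e j * g)%g)) //= big1 => [|l nl].
    by rewrite !mxE e'K eqxx mulr1 addr0.
  rewrite !mxE; case: (e l =P (e j * g)%g) => [el|_]; last by rewrite mulr0.
  by rewrite -el eK eqxx in nl.
pose o := e' 1%g.
have Pg i g : P i (e' g) = X i g * P i o by rewrite -PX e'K mul1g.
have Po i : P i o != 0.
  apply/eqP => Po0; have r0 : row i P = 0.
    by apply/rowP => j; rewrite !mxE -[j]eK Pg Po0 mulr0.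
  have Pfree : row_free P by rewrite row_free_unit.
  have /matrixP/(_ 0 i)/eqP : delta_mx (0 : 'I_1) i = 0 :> 'rV[k]_N.+1.
    by apply: (row_free_inj Pfree); rewrite -rowE r0 mul0mx.
  by rewrite !mxE !eqxx oner_eq0.
exists X; split=> [i|].
  split=> [|g h]; apply: (mulIf (Po i)).
    by rewrite -Pg mul1r.
  by rewrite -Pg mulrAC -Pg mulrC -PX e'K.
have PE : P = diag_mx (\row_i P i o) *m (\matrix_(i, j) X i (e j)).
  by apply/matrixP => i j; rewrite mul_diag_mx !mxE mulrC -Pg eK.
by move: Pu; rewrite PE unitmx_mul => /andP[].
Qed.

End CharacterTable.

(** Some |S| rows of the character table remain independent, and in particular
    distinct, once restricted to the columns in S. *)
Lemma exists_separating_characters (z : k) (S : {group gT}) m :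
    abelian [set: gT] -> #|gT|.-primitive_root z -> #|S| = m ->
  exists chi : 'I_m -> gT -> k,
    (forall i, lin_char (chi i)) /\
    (forall i j, {in S, chi i =1 chi j} -> i = j).
Proof.
move=> abG zP <-{m}.
have oG : #|gT| = #|gT|.-1.+1 by rewrite prednK // -cardsT cardG_gt0.
pose e i : gT := enum_val (cast_ord (esym oG) i).
pose e' g := cast_ord oG (enum_rank g).
have eK : cancel e e' by move=> i; rewrite /e /e' enum_valK cast_ordKV.
have e'K : cancel e' e by move=> g; rewrite /e /e' cast_ordK enum_rankK.
rewrite oG in zP.
have [X [Xc Xu]] := character_table_unit eK e'K abG zP.
pose Y := \matrix_(i < #|gT|.-1.+1, j < #|S|) X i (enum_val j).
have Yfull : row_full Y.
  (* The rows indexed by S of the inverse table form a left inverse of Y. *)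
  apply/row_fullP; exists (rowsub (fun j => e' (enum_val j))
    (invmx (\matrix_(i, j) X i (e j)))).
  apply/matrixP => i j.
  have /matrixP/(_ (e' (enum_val i)) (e' (enum_val j))) := mulVmx Xu.
  rewrite !mxE (inj_eq (can_inj e'K)) (inj_eq enum_val_inj) => <-.
  by apply: eq_bigr => l _; rewrite !mxE e'K.
exists (fun i => X (fullrankfun Yfull i)); split=> // i j Xij.
have : delta_mx (0 : 'I_1) i = delta_mx 0 j :> 'rV[k]_#|S|.
  apply: (row_free_inj (fullrowsub_free Yfull)); rewrite -!rowE.
  by apply/rowP => l; rewrite !mxE; apply/Xij/enum_valP.
have [-> //|nij] := eqVneq i j.
by move/rowP/(_ i)/eqP; rewrite !mxE !eqxx (negPf nij) oner_eq0.
Qed.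

Section Orthogonality.
Variables (S : {group gT}) (m : nat) (chi : 'I_m -> gT -> k).
Hypotheses (cardS : #|S| = m) (m0 : m%:R != 0 :> k).
Hypothesis chiP : forall i, lin_char (chi i).
Hypothesis chi_sep : forall i j, {in S, chi i =1 chi j} -> i = j.

Lemma char_orthogonality i j :
  \sum_(s in S) chi i s * (chi j s)^-1 = m%:R *+ (i == j).
Proof.
case: (i =P j) => [<-|nij].
  under eq_bigr => s _ do rewrite mulfV ?lin_char_neq0 //.
  by rewrite sumr_const cardS.
have [s sS ns] : exists2 s, s \in S & chi i s != chi j s.
  apply/forall_inPn/negP => /forall_inP eq_ij.
  by apply: nij; apply: chi_sep => s sS; apply/eqP/eq_ij.
(* The sum of a character over S is unchanged when multiplied by its value at
   any s in S, so it vanishes if one of these values is not 1. *)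
set A := LHS; pose psi g := chi i g * (chi j g)^-1.
have psiA : psi s * A = A.
  rewrite /A mulr_sumr [RHS](reindex_inj (mulgI s)) /=; apply: eq_big => t.
    by rewrite groupMl.
  by move=> _; rewrite (chiP i).2 (chiP j).2 invfM mulrACA.
have : (psi s - 1) * A = 0 by rewrite mulrBl psiA mul1r subrr.
move/eqP; rewrite mulf_eq0 subr_eq0 => /orP[|/eqP->//].
move/eqP/(congr1 ( *%R^~ (chi j s))).
by rewrite mulfVK ?lin_char_neq0 // mul1r => /eqP; rewrite (negPf ns).
Qed.

(** Row orthogonality gives a right inverse of the table of the [chi i] on S; as
    the table is square, this is a left inverse too, which gives the
    orthogonality of the columns of s and of 1. *)
Lemma char_orthogonality_dual s :
  s \in S -> \sum_i chi i s = m%:R *+ (s == 1%g).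
Proof.
move=> sS.
pose x (j : 'I_m) : gT := enum_val (cast_ord (esym cardS) j).
pose A := \matrix_(i, j) chi i (x j).
pose A' := \matrix_(j, i) (m%:R^-1 * (chi i (x j))^-1).
(* [A] is square because there are as many characters as elements of S. *)
have AA' : A *m A' = 1%:M.
  apply/matrixP => i j; rewrite !mxE.
  have := char_orthogonality i j; rewrite big_enum_val.
  rewrite (reindex (cast_ord (esym cardS))) /=; last first.
    by exists (cast_ord cardS) => l _; rewrite ?cast_ordKV ?cast_ordK.
  move=> orth; rewrite -[RHS](mulKf m0) mulr_natr -orth mulr_sumr.
  by apply: eq_bigr => l _; rewrite !mxE mulrCA.
pose r t (tS : t \in S) := cast_ord cardS (enum_rank_in tS t).
have xr t (tS : t \in S) : x (r t tS) = t.
  by rewrite /x /r cast_ordK enum_rankK_in.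
have /matrixP/(_ (r _ (group1 S)) (r _ sS)) := mulmx1C AA'.
rewrite !mxE => H; apply: (mulfI (invr_neq0 m0)).
rewrite mulr_sumr.
transitivity (\sum_j A' (r _ (group1 S)) j * A j (r _ sS)).
  by apply: eq_bigr => i _; rewrite !mxE !xr (chiP i).1 invr1 mulr1.
have -> : (s == 1%g) = (r _ (group1 S) == r _ sS).
  apply/eqP/eqP => [s1|/(congr1 x)]; last by rewrite !xr.
  by apply/(congr1 (cast_ord cardS))/enum_val_inj; rewrite !enum_rankK_in.
by rewrite H; case: eqP => _; rewrite ?mulr0 // mulVf.
Qed.

End Orthogonality.
End Characters.

(** * The algebra B as functions on its idempotents *)

Section Action.
Variables (k : fieldType) (gT : finGroupType) (B : algType k).
Variable M : module_alg gT B.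
Local Notation act g b := (M (gelt k g) b).

Lemma gelt_act_linear g : linear (fun b => act g b).
Proof. exact: hact_linearr. Qed.

HB.instance Definition _ g :=
  GRing.isLinear.Build k B B _ (M (gelt k g)) (gelt_act_linear g).

Lemma gelt_actM g b c : act g (b * c) = act g b * act g c.
Proof. by rewrite hact_mul sweedler_gelt. Qed.

Lemma gelt_act1 b : act 1%g b = b.
Proof. exact: hact1. Qed.

Lemma gelt_actA g h b : act (g * h)%g b = act g (act h b).
Proof. by rewrite -gelt_mul hactM. Qed.

Lemma gelt_actK g : cancel (fun b => act g b) (fun b => act g^-1%g b).
Proof. by move=> b; rewrite -gelt_actA mulVg gelt_act1. Qed.

Lemma gelt_actVK g : cancel (fun b => act g^-1%g b) (fun b => act g b).
Proof. by move=> b; rewrite -gelt_actA mulgV gelt_act1. Qed.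

End Action.

Section Idempotents.
Variables (k : fieldType) (B : falgType k) (F : {fset B}).
Hypothesis FP : orth_idem_basis F.

Lemma idem_neq0 f : f \in F -> f != 0.
Proof.
by move=> fF; case: FP => Fb _ _; apply: free_not0 (basis_free Fb) fF.
Qed.

(** For f in F the product b * f lies on the line spanned by f; its coordinate
    there is the value at f of b seen as a function on F. *)
Definition eval_at (f b : B) : k := coord [tuple f] ord0 (b * f).

Lemma eval_at_linear f : linear (eval_at f : B -> k^o).
Proof. by move=> a b c; rewrite /eval_at mulrDl -scalerAl linearP. Qed.

HB.instance Definition _ f :=
  GRing.isLinear.Build k B k^o _ (eval_at f) (eval_at_linear f).

Lemma eval_atP f a b c : eval_at f (a *: b + c) = a * eval_at f b + eval_at f c.
Proof. exact: eval_at_linear. Qed.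

Lemma eval_atZ f a b : eval_at f (a *: b) = a * eval_at f b.
Proof. exact: (linearZ_LR (eval_at f)). Qed.

Lemma eval_at0 f : eval_at f 0 = 0.
Proof. exact: linear0. Qed.

Lemma eval_at_sum f (I : Type) (s : seq I) (P : pred I) (G : I -> B) :
  eval_at f (\sum_(i <- s | P i) G i) = \sum_(i <- s | P i) eval_at f (G i).
Proof. exact: (linear_sum (eval_at f)). Qed.

Lemma idem_mul f g : f \in F -> g \in F -> f * g = (f == g)%:R *: f.
Proof. by case: FP => _ _; apply. Qed.

Lemma basis_expand b : exists c : B -> k, b = \sum_(f <- F) c f *: f.
Proof.
case: FP => Fb _ _.
have /coord_span -> : b \in span (in_tuple F).
  by rewrite (span_basis Fb) memvf.
exists (fun f =>
  if insub (index f F) is Some i then coord (in_tuple F) i b else 0).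
rewrite (big_nth 0) big_mkord; apply: eq_bigr => i _.
by rewrite index_uniq // valK.
Qed.

Lemma eval_at_mulr f b : f \in F -> b * f = eval_at f b *: f.
Proof.
move=> fF; have : b * f \in <[f]>%VS.
  have [c ->] := basis_expand b; rewrite mulr_suml big_seq memv_suml // => g gF.
  rewrite -scalerAl idem_mul //.
  case: eqP => [->|_]; last by rewrite scale0r scaler0 mem0v.
  by rewrite scale1r memvZ ?memv_line.
rewrite -span_seq1 => /(@coord_span _ _ _ [tuple f]).
by rewrite big_ord1.
Qed.

Lemma eval_at_unique f b c : f \in F -> b * f = c *: f -> eval_at f b = c.
Proof.
move=> fF bf; apply/eqP; rewrite -subr_eq0.
have : (eval_at f b - c) *: f == 0.
  by rewrite scalerBl -eval_at_mulr // bf subrr.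
by rewrite scaler_eq0 (negPf (idem_neq0 fF)) orbF.
Qed.

Lemma eval_at1 f : f \in F -> eval_at f 1 = 1.
Proof. by move=> fF; apply: eval_at_unique; rewrite // mul1r scale1r. Qed.

Lemma eval_atM f b c : f \in F -> eval_at f (b * c) = eval_at f b * eval_at f c.
Proof.
move=> fF; apply: eval_at_unique => //.
by rewrite -mulrA (eval_at_mulr c) // -scalerAr eval_at_mulr // scalerA mulrC.
Qed.

Lemma eval_at_idem f g : f \in F -> g \in F -> eval_at f g = (g == f)%:R.
Proof.
move=> fF gF; apply: eval_at_unique; rewrite // idem_mul //.
by case: eqP => [->|]; rewrite ?scale0r.
Qed.

Lemma eval_at_expand b : b = \sum_(f <- F) eval_at f b *: f.
Proof.
case: FP => _ F1 _; rewrite -[LHS]mulr1 F1 mulr_sumr.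
by apply: eq_big_seq => f fF; rewrite eval_at_mulr.
Qed.

(** B is commutative because F spans it, so b acts on f by the same scalar from
    either side. *)
Lemma eval_at_mull f b : f \in F -> f * b = eval_at f b *: f.
Proof.
move=> fF; rewrite {1}[b]eval_at_expand mulr_sumr (big_rem f) //= big_seq big1.
  by rewrite -scalerAr idem_mul // eqxx scale1r addr0.
move=> g; rewrite mem_rem_uniq ?fset_uniq // inE => /andP[ngf gF].
by rewrite -scalerAr idem_mul // eq_sym (negPf ngf) scale0r scaler0.
Qed.

Section IdempotentAction.
Variables (gT : finGroupType) (M : module_alg gT B).
Local Notation act g b := (M (gelt k g) b).

(** The element b = act g f is not killed by some f' in F.  Then f' * b is a
    nonzero multiple of f', and also, carried back by g^-1, a multiple of b; so
    b is a multiple of f', and proportional nonzero idempotents are equal. *)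
Lemma act_idem g f : f \in F -> act g f \in F.
Proof.
move=> fF; set b := act g f.
have bn0 : b != 0.
  apply: contra_neq (idem_neq0 fF) => b0.
  by rewrite -[f](gelt_actK M g) -/b b0 linear0.
have [f' f'F cn0] : exists2 f', f' \in F & eval_at f' b != 0.
  apply/(@hasP _ (fun f' => eval_at f' b != 0) F); apply: contraR bn0.
  rewrite -all_predC => /allP all0.
  rewrite [b]eval_at_expand big_seq big1 // => f' /all0 /= /negPn/eqP ->.
  by rewrite scale0r.
have bf' : f' * b = eval_at f (act g^-1%g f') *: b.
  by rewrite -{1}[f'](gelt_actVK M g) -gelt_actM eval_at_mulr // linearZ.
rewrite eval_at_mull // in bf'.
have [d bE] : exists d, b = d *: f'.
  have [d0|dn0] := eqVneq (eval_at f (act g^-1%g f')) 0.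
    move/eqP: bf'; rewrite d0 scale0r scaler_eq0 (negPf cn0) /=.
    by rewrite (negPf (idem_neq0 f'F)).
  exists ((eval_at f (act g^-1%g f'))^-1 * eval_at f' b).
  by rewrite -scalerA bf' scalerA mulVf // scale1r.
have dd : d * d = d.
  have bb : b * b = b by rewrite -gelt_actM idem_mul // eqxx scale1r.
  have : (d * d - d) *: f' == 0.
    rewrite scalerBl -bE -{1}[b]bb bE -scalerAl -scalerAr scalerA.
    by rewrite idem_mul // eqxx scale1r subrr.
  by rewrite scaler_eq0 (negPf (idem_neq0 f'F)) orbF subr_eq0 => /eqP.
have d1 : d = 1.
  have dn0 : d != 0 by apply: contraNneq bn0 => d0; rewrite bE d0 scale0r.
  by apply: (mulfI dn0); rewrite dd mulr1.
by rewrite bE d1 scale1r.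
Qed.

Lemma act_basis g : [fset act g f | f in F]%fset = F.
Proof.
apply/fsetP => f; apply/imfsetP/idP => [[f' f'F ->]|fF]; first exact: act_idem.
by exists (act g^-1%g f); rewrite ?act_idem //= gelt_actVK.
Qed.

Lemma eval_at_act g f b :
  f \in F -> eval_at f (act g b) = eval_at (act g^-1%g f) b.
Proof.
move=> fF; have f'F := act_idem g^-1%g fF.
apply: eval_at_unique => //; rewrite -{1}[f](gelt_actVK M g) -gelt_actM.
by rewrite eval_at_mulr // linearZ /= gelt_actVK.
Qed.

End IdempotentAction.
End Idempotents.

(** * Matrix blocks of the smash product *)

Section Block.
Variables (k : fieldType) (gT : finGroupType) (B : falgType k).
Variables (F : {fset B}) (M : module_alg gT B).
Hypothesis FP : orth_idem_basis F.
Local Notation act g b := (M (gelt k g) b).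

Variables (r : nat) (p : 'I_r -> B).
Hypothesis pF : forall a, p a \in F.
Hypothesis p_inj : injective p.
Hypothesis p_act : forall g a, exists b, act g (p a) = p b.

(** The matrix of u acting on the functions on the orbit p, where b in B acts by
    multiplication and g by chi g times the translation of points. *)
Definition block (chi : gT -> k) (u : smash M) : 'M[k]_r :=
  \matrix_(a, b) \sum_(g | act g (p b) == p a) chi g * eval_at (p a) (u g).

Lemma block_linear chi : linear (block chi).
Proof.
move=> c u v; apply/matrixP => a b; rewrite !mxE mulr_sumr -big_split.
apply: eq_bigr => g _ /=; rewrite !ffunE eval_atP /=.
by rewrite mulrDr; congr (_ + _); rewrite mulrCA.
Qed.

Lemma block1 chi : lin_char chi -> block chi 1 = 1.
Proof.
move=> [chi1 _]; apply/matrixP => a b; rewrite !mxE.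
have one_at g : (1 : smash M) g = (g == 1%g)%:R *: 1 by rewrite !ffunE.
rewrite big_mkcond (bigD1 1%g) //= big1 => [|g ng].
  rewrite gelt_act1 (inj_eq p_inj) addr0 one_at eqxx scale1r.
  by rewrite (eval_at1 FP) // chi1 mulr1 eq_sym; case: eqP.
by rewrite one_at (negPf ng) scale0r eval_at0 mulr0 if_same.
Qed.

Lemma blockM chi u v :
  lin_char chi -> block chi (u * v) = block chi u * block chi v.
Proof.
move=> [_ chiM]; apply/matrixP => a b; rewrite !mxE.
under eq_bigr => x _ do rewrite smulE eval_at_sum mulr_sumr /=.
under [RHS]eq_bigr => c _ do rewrite !mxE mulr_suml.
rewrite [LHS]exchange_big [RHS](exchange_big_dep predT) //=.
apply: eq_bigr => g _.
have [c ac] := p_act g^-1%g a.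
have gc : act g (p c) = p a by rewrite -ac gelt_actVK.
have c_uniq d : (act g (p d) == p a) = (d == c).
  apply/eqP/eqP => [gd|->//]; apply: p_inj.
  by rewrite -[p d](gelt_actK M g) gd ac.
(* For a fixed g, only the point c with p c = g^-1 p a is intermediate between b
   and a, and x = g * y carries b to a exactly when y carries b to c. *)
rewrite (eq_bigl _ _ c_uniq) big_pred1_eq mulr_sumr.
rewrite (reindex_inj (mulgI g)) /=; apply: eq_big => y.
  by rewrite gelt_actA -{1}gc (inj_eq (can_inj (gelt_actK M g))).
move=> _; rewrite chiM (eval_atM FP) // (eval_at_act FP) // ac mulKg.
by rewrite mulrACA.
Qed.

Variables (S : {group gT}) (m : nat) (chi : 'I_m -> gT -> k).
Hypothesis p_trans : forall a b, exists g, act g (p b) = p a.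
Hypothesis p_stab : forall g a, (act g (p a) == p a) = (g \in S).
Hypotheses (cardS : #|S| = m) (m0 : m%:R != 0 :> k).
Hypothesis chiP : forall i, lin_char (chi i).
Hypothesis chi_sep : forall i j, {in S, chi i =1 chi j} -> i = j.

(** The elements carrying p b to p a form the coset g0 S, because S is the
    stabiliser of p b. *)
Lemma transporter_sum (V : nmodType) (f : gT -> V) g0 a b :
  act g0 (p b) = p a ->
  \sum_(g | act g (p b) == p a) f g = \sum_(s in S) f (g0 * s)%g.
Proof.
move=> g0b; rewrite (reindex_inj (mulgI g0)) /=; apply: eq_bigl => s.
by rewrite gelt_actA -g0b (inj_eq (can_inj (gelt_actK M g0))) p_stab.
Qed.

Lemma orbit_stabiliser (b : 'I_r) : (r * #|S|)%N = #|gT|.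
Proof.
have count_transporter a : (\sum_(g | act g (p b) == p a) 1 = #|S|)%N.
  have [g0 g0b] := p_trans a b; rewrite -[RHS]sum1_card.
  exact: (transporter_sum (fun=> 1%N) g0b).
have <- : (\sum_a \sum_(g | act g (p b) == p a) 1 = r * #|S|)%N.
  under eq_bigr => a _ do rewrite count_transporter.
  by rewrite sum_nat_const card_ord.
rewrite -sum1_card (exchange_big_dep predT) //=; apply: eq_bigr => g _.
have [c gc] := p_act g b.
by apply: (big_pred1 c) => a /=; rewrite gc (inj_eq p_inj) eq_sym.
Qed.

(** Fourier inversion on the coset g S: by orthogonality, only the term of g is
    left in the sum over the coset. *)
Lemma block_inversion u g a b : act g (p b) = p a ->
  \sum_i (chi i g)^-1 * block (chi i) u a b = m%:R * eval_at (p a) (u g).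
Proof.
move=> gb; under eq_bigr => i _ do
  rewrite mxE (transporter_sum _ gb) mulr_sumr.
rewrite exchange_big /= (bigD1 1%g) //= [X in _ + X]big1 => [|s /andP[sS ns]].
  under eq_bigr => i _ do
    rewrite mulg1 mulKf ?(lin_char_neq0 _ (chiP i)) //.
  by rewrite sumr_const card_ord addr0 mulr_natl.
under eq_bigr => i _ do
  rewrite (chiP i).2 mulrA mulKf ?(lin_char_neq0 _ (chiP i)) //.
rewrite -mulr_suml (char_orthogonality_dual cardS m0 chiP chi_sep sS).
by rewrite (negPf ns) mul0r.
Qed.

(** The value at p a of the coefficient of g in the preimage of the matrices Q,
    as [block_inversion] imposes it; the outer sum has a single term, the b such
    that g carries p b to p a. *)
Definition unblock (Q : 'I_m -> 'M[k]_r) (a : 'I_r) (g : gT) : k :=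
  m%:R^-1 * \sum_(b | act g (p b) == p a) \sum_i (chi i g)^-1 * Q i a b.

Lemma block_unblock Q (u : smash M) :
    (forall a g, eval_at (p a) (u g) = unblock Q a g) ->
  forall i, block (chi i) u = Q i.
Proof.
move=> uQ i; apply/matrixP => a b; rewrite mxE; have [g0 g0b] := p_trans a b.
have wE g : act g (p b) == p a ->
    unblock Q a g = m%:R^-1 * \sum_i (chi i g)^-1 * Q i a b.
  move=> /eqP gb; congr (_ * _); apply: (big_pred1 b) => c /=.
  by rewrite -gb (inj_eq (can_inj (gelt_actK M g))) (inj_eq p_inj).
under eq_bigr => g gb do rewrite uQ wE // mulrCA mulr_sumr.
rewrite -mulr_sumr exchange_big /=.
under eq_bigr => j _.
  under eq_bigr => g _ do rewrite mulrA.
  rewrite -mulr_suml (transporter_sum _ g0b).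
  under eq_bigr => s _ do
    rewrite (chiP i).2 (chiP j).2 invfM mulrACA.
  rewrite -mulr_sumr (char_orthogonality cardS chiP chi_sep i j).
  over.
rewrite (bigD1 i) //= big1 => [|j nji].
  by rewrite eqxx mulfV ?(lin_char_neq0 _ (chiP i)) // mul1r addr0 mulKf.
by rewrite eq_sym (negPf nji) mulr0 mul0r.
Qed.

End Block.

(* The family [p] lists the idempotents without repetition, one orbit for each
   [l], and [S l] is the stabiliser of every point of the orbit [l]. *)
Section Decomposition.
Variables (k : fieldType) (gT : finGroupType) (B : falgType k).
Variables (F : {fset B}) (M : module_alg gT B).
Hypothesis FP : orth_idem_basis F.
Local Notation act g b := (M (gelt k g) b).

Variables (I : finType) (r m : I -> nat).
Variables (p : forall l : I, 'I_(r l) -> B) (S : I -> {group gT}).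
Arguments p : clear implicits.
Hypothesis pF : forall l a, p l a \in F.
Hypothesis p_inj : forall l, injective (p l).
Hypothesis p_disj : forall l l' a a', p l a = p l' a' -> l = l'.
Hypothesis p_surj : forall f, f \in F -> exists l a, f = p l a.
Hypothesis p_act : forall l g a, exists b, act g (p l a) = p l b.
Hypothesis p_trans : forall l a b, exists g, act g (p l b) = p l a.
Hypothesis p_stab : forall l g a, (act g (p l a) == p l a) = (g \in S l).
Hypotheses (cardS : forall l, #|S l| = m l).
Hypotheses (abG : abelian [set: gT]).
Variable (z : k).
Hypothesis (zP : #|gT|.-primitive_root z).

Local Notation target :=
  (prodalg (fun l : I => {ffun 'I_(m l) -> 'M[k]_(r l)})).

Lemma smash_iso : exists phi : {lrmorphism smash M -> target}, bijective phi.
Proof.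
have [chi chiP] := fin_all_exists
  (fun l => exists_separating_characters abG zP (cardS l)).
have m0 l : (m l)%:R != 0 :> k.
  apply: (prim_root_dvd_eq0 zP); rewrite -(cardS l) -cardsT.
  exact/cardSg/subsetT.
pose phi (u : smash M) : target :=
  [ffun l => [ffun i => block (p l) (chi l i) u]].
have phi_lin : linear phi.
  by move=> c u v; apply/ffunP => l; rewrite !ffunE; apply/ffunP => i;
    rewrite !ffunE block_linear.
have phi1 : phi 1 = 1.
  apply/ffunP => l; rewrite !ffunE; apply/ffunP => i; rewrite !ffunE.
  by apply: (block1 _ FP) => //; apply: (chiP l).1.
have phiM : {morph phi : u v / u * v}.
  move=> u v; apply/ffunP => l; rewrite !ffunE; apply/ffunP => i.
  rewrite !ffunE; apply: (blockM FP) => //; exact: (chiP l).1.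
pose phi_isL := GRing.isLinear.Build k (smash M) target _ phi phi_lin.
pose phi_isM := GRing.isMonoidMorphism.Build (smash M) target phi (phi1, phiM).
pose Phi : {lrmorphism smash M -> target} := HB.pack phi phi_isL phi_isM.
pose psi (Q : target) : smash M :=
  [ffun g => \sum_l \sum_a unblock M (p l) (chi l) (Q l) a g *: p l a].
have psi_eval Q l a g :
    eval_at (p l a) (psi Q g) = unblock M (p l) (chi l) (Q l) a g.
  rewrite ffunE eval_at_sum (bigD1 l) //= [X in _ + X]big1 => [|l' nl];
    last first.
    rewrite eval_at_sum big1 // => a' _.
    rewrite eval_atZ (eval_at_idem FP) //.
    case: eqP => [/p_disj|_]; last by rewrite mulr0.
    by move/eqP; rewrite (negPf nl).
  rewrite addr0 eval_at_sum (bigD1 a) //= big1 => [|a' na].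
    by rewrite eval_atZ addr0 (eval_at_idem FP) // eqxx mulr1.
  by rewrite eval_atZ (eval_at_idem FP) // (inj_eq (@p_inj l)) (negPf na) mulr0.
have psiK : cancel psi phi.
  move=> Q; apply/ffunP => l; rewrite ffunE; apply/ffunP => i; rewrite ffunE.
  have [chil chi_sep] := chiP l.
  exact: (block_unblock (@p_inj l) (@p_trans l) (@p_stab l) (cardS l) (m0 l)
    chil chi_sep (fun a g => psi_eval Q l a g)).
have phi_inj : injective phi.
  move=> u v uv; apply/ffunP => g.
  rewrite [u g](eval_at_expand FP) [v g](eval_at_expand FP).
  apply: eq_big_seq => f fF; congr (_ *: _).
  have [l [a ->]] := p_surj fF; have [b ab] := p_act g^-1%g a.
  have gb : act g (p l b) = p l a by rewrite -ab gelt_actVK.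
  have [chil chi_sep] := chiP l.
  apply: (mulfI (m0 l)).
  rewrite -!(block_inversion (@p_stab l) (cardS l) (m0 l) chil chi_sep _ gb).
  apply: eq_bigr => i _; congr (_ * _).
  have /ffunP/(_ l) := uv; rewrite !ffunE => /ffunP/(_ i).
  by rewrite !ffunE => ->.
exists Phi; exists psi => //; exact: inj_can_sym psiK phi_inj.
Qed.

End Decomposition.

(** * Semisimplicity of products of matrix algebras *)

(** The left ideals A (e t) form a direct decomposition of A; by the last
    hypothesis, every nonzero element of A (e t) generates it. *)
Lemma semisimple_of_idempotents (A : pzRingType) (T : finType) (e : T -> A) :
    \sum_t e t = 1 -> (forall s t, s != t -> e s * e t = 0) ->
    (forall t, e t != 0) ->
    (forall t a, a * e t != 0 -> exists b, b * (a * e t) = e t) ->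
  semisimple_alg A.
Proof.
move=> e1 e_orth e_neq0 e_min.
have ee t : e t * e t = e t.
  rewrite -[RHS]mulr1 -e1 mulr_sumr (bigD1 t) //= big1 ?addr0 // => s ns.
  by rewrite e_orth // eq_sym.
exists #|T|, (fun i x => x * e (enum_val i) = x); split=> [i|a].
  split.
  - split=> [|x y xe ye|a x xe]; first by rewrite mul0r.
      by rewrite mulrDl xe ye.
    by rewrite -mulrA xe.
  - by exists (e (enum_val i)); rewrite ?ee.
  move=> J [J0 JD JM] JL [y Jy y0] x <-; apply: (JM).
  have ye := JL _ Jy; rewrite -ye in y0.
  by have [b <-] := e_min _ _ y0; rewrite ye; apply: JM.
exists [ffun i => a * e (enum_val i)]; split=> [|u [uL ->]].
  split=> [i|]; first by rewrite ffunE -mulrA ee.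
  under eq_bigr => i _ do rewrite ffunE.
  by rewrite -mulr_sumr -big_enum_val e1 mulr1.
apply/ffunP => j; rewrite ffunE mulr_suml (bigD1 j) //= big1 => [|i ni].
  by rewrite uL addr0.
by rewrite -uL -mulrA e_orth ?mulr0 // (inj_eq enum_val_inj).
Qed.

Section MatrixProduct.
Variables (k : fieldType) (I : finType) (r m : I -> nat).
Local Notation target :=
  (prodalg (fun l : I => {ffun 'I_(m l) -> 'M[k]_(r l)})).
(* A place is a diagonal position (l, i, a): the position (a, a) in the i-th
   matrix factor of the component l. *)
Local Notation place := {l : I & ('I_(m l) * 'I_(r l))%type}.
Local Notation at_ l i a :=
  (Tagged (fun l : I => ('I_(m l) * 'I_(r l))%type) (i, a) : place).

(** The diagonal matrix unit at t.  Comparing places rather than l, i and a one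
    by one avoids casts between the matrix types of different components. *)
Definition unit_at (t : place) : target :=
  [ffun l => [ffun i => \matrix_(a, b) ((t == at_ l i a) && (a == b))%:R]].

Lemma mul_unit_at (X : target) t l i a b :
  (X * unit_at t) l i a b = X l i a b * (t == at_ l i b)%:R.
Proof.
rewrite !ffunE !mxE (bigD1 b) //= big1 => [|c nc]; rewrite mxE.
  by rewrite eqxx andbT addr0.
by rewrite (negPf nc) andbF mulr0.
Qed.

Lemma targetP (X Y : target) : (forall l i a b, X l i a b = Y l i a b) -> X = Y.
Proof.
by move=> XY; apply/ffunP => l; apply/ffunP => i; apply/matrixP => a b.
Qed.

Lemma unit_at_sum : \sum_t unit_at t = 1.
Proof.
have sumE (G : place -> target) l i a b :
    (\sum_t G t) l i a b = \sum_t G t l i a b.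
  by apply: (big_morph (fun X : target => X l i a b)) => [X Y|];
    rewrite !ffunE !mxE.
apply: targetP => l i a b; rewrite sumE (bigD1 (at_ l i a)) //= big1 => [|t nt].
  by rewrite !ffunE !mxE eqxx addr0.
by rewrite !ffunE !mxE (negPf nt).
Qed.

Lemma unit_at_orth s t : s != t -> unit_at s * unit_at t = 0.
Proof.
move=> nst; apply: targetP => l i a b; rewrite mul_unit_at !ffunE !mxE.
case: (t =P _) => [tE|]; last by rewrite mulr0.
case: (a =P b) => [ab|]; last by rewrite andbF mul0r.
by rewrite ab -tE (negPf nst) mul0r.
Qed.

Lemma unit_at_neq0 t : unit_at t != 0.
Proof.
case: t => l [i a]; apply/eqP => /ffunP/(_ l); rewrite !ffunE => /ffunP/(_ i).
rewrite !ffunE => /matrixP/(_ a a)/eqP.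
by rewrite !mxE !eqxx oner_eq0.
Qed.

(** Only the column of t is left in X * unit_at t; if its entry in row a0 is x,
    the matrix unit that moves row a0 to row j0, divided by x, turns this column
    into that of unit_at t. *)
Lemma unit_at_min t X :
  X * unit_at t != 0 -> exists Y, Y * (X * unit_at t) = unit_at t.
Proof.
case: t => l0 [i0 j0]; set t := at_ l0 i0 j0 => Xt.
have [a0 xn0] : exists a0, X l0 i0 a0 j0 != 0.
  apply/existsP; apply: contraR Xt => /existsPn X0.
  apply/eqP/targetP => l i a b; rewrite mul_unit_at !ffunE mxE.
  case: (t =P at_ l i b) => [tE|]; last by rewrite mulr0.
  have ll : l0 = l by have := congr1 (@tag _ _) tE.
  move: i a b tE; rewrite -ll => i a b /eqP; rewrite eq_Tagged => /eqP[<- <-].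
  by have /negPn/eqP -> := X0 a; rewrite mul0r.
pose Y : target := [ffun l => [ffun i : 'I_(m l) => \matrix_(a < r l, b < r l)
  ((X l0 i0 a0 j0)^-1 * ((t == at_ l i a) && (at_ l0 i0 a0 == at_ l i b))%:R)]].
exists Y; apply: targetP => l i a b.
rewrite mulrA mul_unit_at.
case: (t =P at_ l i b) => [tE|tE]; last first.
  rewrite mulr0 !ffunE mxE; case: (a =P b) => [->|_]; last by rewrite andbF.
  by rewrite andbT; case: eqP.
have ll : l0 = l by have := congr1 (@tag _ _) tE.
move: i a b tE; rewrite -ll => i a b /eqP; rewrite eq_Tagged => /eqP[<- <-].
rewrite mulr1 !ffunE !mxE (bigD1 a0) //= big1 => [|c nc]; rewrite !mxE.
  rewrite !eq_Tagged /= !xpair_eqE !eqxx /= addr0 andbT (eq_sym j0).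
  by case: eqP => _; rewrite ?mulr0 ?mul0r // mulr1 mulVf.
rewrite (_ : (at_ _ _ _ == at_ _ _ c) = false) ?andbF ?mulr0 ?mul0r //.
by rewrite eq_Tagged /= xpair_eqE eqxx eq_sym (negPf nc).
Qed.

End MatrixProduct.

Lemma semisimple_of_iso (A : pzRingType) (k : fieldType) (I : finType)
    (r m : I -> nat)
    (phi : {rmorphism A ->
      prodalg (fun l : I => {ffun 'I_(m l) -> 'M[k]_(r l)})}) :
  bijective phi -> semisimple_alg A.
Proof.
move=> [psi phiK psiK]; have phi_inj := can_inj phiK.
apply: (@semisimple_of_idempotents _ _ (fun t => psi (unit_at k t))).
- apply: phi_inj; rewrite rmorph_sum rmorph1 -unit_at_sum.
  by apply: eq_bigr => t _; rewrite psiK.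
- move=> s t nst; apply: phi_inj.
  by rewrite rmorphM rmorph0 !psiK unit_at_orth.
- move=> t; rewrite -(inj_eq phi_inj) rmorph0 psiK; exact: unit_at_neq0.
move=> t a; rewrite -(inj_eq phi_inj) rmorphM rmorph0 psiK.
move=> /unit_at_min[Y YE].
by exists (psi Y); apply: phi_inj; rewrite !rmorphM !psiK.
Qed.

(** * Orbits of idempotents *)

Section OrbitOf.
Variables (k : fieldType) (gT : finGroupType) (B : algType k).
Variable M : module_alg gT B.
Local Notation act g b := (M (gelt k g) b).

Lemma orbit_ofP x f : reflect (exists g, x = act g f) (x \in orbit_of M f).
Proof.
by apply: (iffP (imfsetP _ _ _ _)) => [[g _ ->]|[g ->]]; exists g.
Qed.

Lemma mem_orbit_of f : f \in orbit_of M f.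
Proof. by apply/orbit_ofP; exists 1%g; rewrite gelt_act1. Qed.

Lemma orbit_of_eq x f : x \in orbit_of M f -> orbit_of M f = orbit_of M x.
Proof.
move=> /orbit_ofP[g ->]; apply/fsetP => y; apply/orbit_ofP/orbit_ofP => -[h ->].
  by exists (h * g^-1)%g; rewrite gelt_actA gelt_actK.
by exists (h * g)%g; rewrite gelt_actA.
Qed.

Lemma stabiliser_group_set f : group_set [set g | act g f == f].
Proof.
apply/group_setP; split=> [|g h]; rewrite !inE ?gelt_act1 //.
by rewrite gelt_actA => /eqP gf /eqP ->; rewrite gf.
Qed.

Definition stabiliser f : {group gT} := Group (stabiliser_group_set f).

End OrbitOf.

Theorem theorem3 (k : fieldType) (gT : finGroupType) (n : nat)
    (B : falgType k) (M : module_alg gT B) (F : {fset B}) :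
  abelian [set: gT] ->
  #|gT| = n ->
  (exists z : k, n.-primitive_root z) ->
  power_of_field B ->
  orth_idem_basis F ->
  (forall g : gT, [fset M (gelt k g) f | f in F]%fset = F)
  /\
  let t : nat := #|` orbits M F|%fset in
  let n_ (l : 'I_t) : nat := #|` nth fset0 (orbits M F) l|%fset in
  [/\ semisimple_alg (smash M),
      forall l : 'I_t, (n_ l %| #|gT|)%N
    & exists phi : {lrmorphism smash M ->
          prodalg (fun l : 'I_t => {ffun 'I_(#|gT| %/ n_ l) -> 'M[k]_(n_ l)})},
        bijective phi].
Proof.
move=> abG <-{n} [z zP] _ FP; split=> [g|t n_]; first exact: act_basis.
pose O (l : 'I_t) : {fset B} := nth fset0 (orbits M F) l.
pose p (l : 'I_t) (a : 'I_(n_ l)) : B := nth 0 (O l) a.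
have pO l a : p l a \in O l by apply: mem_nth.
have OF l x : x \in O l -> x \in F /\ O l = orbit_of M x.
  have /imfsetP[f /= fF OE] : O l \in orbits M F by apply: mem_nth.
  rewrite OE => xf; split; last exact: orbit_of_eq.
  by case/orbit_ofP: xf => g ->; apply: act_idem.
have p_onto l x : x \in O l -> exists a, x = p l a.
  move=> xO; have xlt : (index x (O l) < n_ l)%N by rewrite index_mem.
  by exists (Ordinal xlt); rewrite /p nth_index.
have pF l a : p l a \in F by have [] := OF l _ (pO l a).
have p_inj l : injective (p l).
  by move=> a b /eqP; rewrite nth_uniq ?fset_uniq // => /eqP/val_inj.
have p_disj l l' a a' : p l a = p l' a' -> l = l'.
  move=> pp; have [_ O1] := OF l _ (pO l a); have [_ O2] := OF l' _ (pO l' a').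
  apply/val_inj/eqP.
  rewrite -(nth_uniq fset0 (ltn_ord l) (ltn_ord l') (fset_uniq (orbits M F))).
  by rewrite -/(O l) -/(O l') O1 O2 pp.
have p_surj f : f \in F -> exists l a, f = p l a.
  move=> fF; have fO : orbit_of M f \in orbits M F by apply/imfsetP; exists f.
  have ilt : (index (orbit_of M f) (orbits M F) < t)%N by rewrite index_mem.
  exists (Ordinal ilt); apply: p_onto; rewrite /O /= nth_index //.
  exact: mem_orbit_of.
have p_act l g a : exists b, M (gelt k g) (p l a) = p l b.
  apply: p_onto; have [_ ->] := OF l _ (pO l a).
  by apply/orbit_ofP; exists g.
have p_trans l a b : exists g, M (gelt k g) (p l b) = p l a.
  have [_ OE] := OF l _ (pO l b); have := pO l a; rewrite OE.
  by case/orbit_ofP => g ->; exists g.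
have n_gt0 l : (0 < n_ l)%N.
  have /imfsetP[f /= _ OE] : O l \in orbits M F by apply: mem_nth.
  rewrite cardfs_gt0 -/(O l) OE; apply/fset0Pn.
  by exists f; apply: mem_orbit_of.
pose S l := stabiliser M (p l (Ordinal (n_gt0 l))).
(* In an abelian group the stabiliser of one point fixes the whole orbit. *)
have p_stab l g a : (M (gelt k g) (p l a) == p l a) = (g \in S l).
  rewrite inE; have [h <-] := p_trans l a (Ordinal (n_gt0 l)).
  have gh : (g * h = h * g)%g by apply: (centsP abG); rewrite inE.
  by rewrite -gelt_actA gh gelt_actA (inj_eq (can_inj (gelt_actK M h))).
have orb l : (n_ l * #|S l|)%N = #|gT|.
  exact: (orbit_stabiliser (@p_inj l) (p_act l) (p_trans l) (p_stab l)
    (Ordinal (n_gt0 l))).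
have cardS l : #|S l| = (#|gT| %/ n_ l)%N by rewrite -(orb l) mulKn.
have [phi phi_bij] := smash_iso FP pF p_inj p_disj p_surj p_act p_trans p_stab
  cardS abG zP.
split; [exact: semisimple_of_iso phi_bij | | by exists phi].
by move=> l; rewrite -(orb l) dvdn_mulr.
Qed.
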